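(* Let $R$ be an integral domain. Then $R$ is a discrete valuation ring (DVR) if and only if $R$ is a local Noetherian domain whose maximal ideal is invertible.
   Context: All rings are commutative with unity; a local ring is a ring with exactly one maximal ideal. Let $K$ be the fraction field of $R$. The product of $R$-submodules $I_1,I_2$ of $K$ is the $R$-submodule of all finite sums $\sum_i x_i y_i$ with $x_i\in I_1$, $y_i\in I_2$. An $R$-submodule $I$ of $K$ is invertible if there is an $R$-submodule $J$ of $K$ such that $IJ=R$. A discrete valuation of a field $K$ is a surjective group homomorphism $v\colon K^\times \to \mathbb{Z}$ (from the multiplicative group of $K$ to the additive group $\mathbb{Z}$) such that $v(x+y)\ge \min\{v(x),v(y)\}$ for all $x,y\in K^\times$ with $x+y\neq 0$; by convention $v(0)=\infty$. A discrete valuation ring (DVR) is any ring of the form $\mathcal{O}_v=\{x\in K \mid v(x)\ge 0\}$, where $K$ is a field and $v$ is a discrete valuation of $K$. *)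

(* Defs.v *)
From HB Require Import structures.
From mathcomp Require Import all_boot all_order all_algebra.
From mathcomp Require Import boolp classical_sets.

Set Implicit Arguments.
Unset Strict Implicit.
Unset Printing Implicit Defensive.

Import Order.TTheory GRing.Theory Num.Theory.
Local Open Scope classical_set_scope.
Local Open Scope ring_scope.

(* The valuation is a total function on K whose value at 0 is irrelevant: every
   axiom is restricted to K^*, and the convention v(0) = +oo is built into
   [valuation_ring_pred] below. *)
Record discrete_valuation (K : fieldType) := DiscreteValuation {
  dv_fun :> K -> int;
  dvM : forall x y : K, x != 0 -> y != 0 ->
    dv_fun (x * y) = dv_fun x + dv_fun y;
  dv_surj : forall n : int, exists2 x : K, x != 0 & dv_fun x = n;
  dvD : forall x y : K, x != 0 -> y != 0 -> x + y != 0 ->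
    Num.min (dv_fun x) (dv_fun y) <= dv_fun (x + y)
}.

Definition valuation_ring_pred (K : fieldType) (v : discrete_valuation K) :
  {pred K} := [pred x | (x == 0) || (0 <= v x)].

Lemma dv1 (K : fieldType) (v : discrete_valuation K) : v 1 = 0.
Proof.
by apply: (addrI (v 1)); rewrite addr0 -dvM ?oner_eq0 // mulr1.
Qed.

Lemma dvN (K : fieldType) (v : discrete_valuation K) (x : K) : v (- x) = v x.
Proof.
have [->|x0] := eqVneq x 0; first by rewrite oppr0.
have N1 : (-1 : K) != 0 by rewrite oppr_eq0 oner_eq0.
suff vN1 : v (-1) = 0 by rewrite -mulN1r dvM // vN1 add0r.
have : v (-1) + v (-1) = 0 by rewrite -dvM // mulrNN mulr1 dv1.
by move/eqP; rewrite -mulr2n mulrn_eq0 => /eqP.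
Qed.

Lemma valuation_ring_closed (K : fieldType) (v : discrete_valuation K) :
  subring_closed (valuation_ring_pred v).
Proof.
split=> [|x y|x y]; rewrite !inE.
- by rewrite dv1 lexx orbT.
- have [->|x0] := eqVneq x 0; first by rewrite sub0r oppr_eq0 dvN.
  have [->|y0] := eqVneq y 0; first by rewrite subr0 (negPf x0).
  have [//|xy0] := eqVneq (x - y) 0.
  move=> /= vx vy; apply: le_trans (dvD _ _ _ xy0) => //.
    by rewrite dvN le_min vx vy.
  by rewrite oppr_eq0.
- rewrite mulf_eq0; have [//|x0] := eqVneq x 0.
  by have [//|y0 /= vx vy] := eqVneq y 0; rewrite dvM // addr_ge0.
Qed.

HB.instance Definition _ (K : fieldType) (v : discrete_valuation K) :=
  GRing.isSubringClosed.Build K (valuation_ring_pred v)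
    (valuation_ring_closed v).

(* O_v = {x in K | v(x) >= 0}, as a subring of K. *)
Definition valuation_ring (K : fieldType) (v : discrete_valuation K) : Type :=
  {x : K | x \in valuation_ring_pred v}.

HB.instance Definition _ (K : fieldType) (v : discrete_valuation K) :=
  SubType.on (valuation_ring v).
HB.instance Definition _ (K : fieldType) (v : discrete_valuation K) :=
  Choice.on (valuation_ring v).
HB.instance Definition _ (K : fieldType) (v : discrete_valuation K) :=
  [SubChoice_isSubComNzRing of valuation_ring v by <:].

(* "Of the form O_v" means ring-isomorphic to O_v; K is an arbitrary field. *)
Definition is_dvr (R : comNzRingType) : Prop :=
  exists (K : fieldType) (v : discrete_valuation K)
    (f : {rmorphism R -> valuation_ring v}), bijective f.

(* The library's [idealr] only covers proper ideals given by boolean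
   predicates. *)
Definition is_ideal (R : comNzRingType) (I : set R) : Prop :=
  [/\ I 0, forall x y, I x -> I y -> I (x + y) &
      forall r x, I x -> I (r * x)].

Definition is_maximal_ideal (R : comNzRingType) (M : set R) : Prop :=
  [/\ is_ideal M, M <> [set: R] &
      forall J : set R, is_ideal J -> M `<=` J -> J = M \/ J = [set: R]].

Definition is_local (R : comNzRingType) : Prop :=
  exists! M : set R, is_maximal_ideal M.

Definition ideal_span (R : comNzRingType) (n : nat) (g : 'I_n -> R) : set R :=
  [set x | exists a : 'I_n -> R, x = \sum_(i < n) a i * g i].

Definition is_noetherian (R : comNzRingType) : Prop :=
  forall I : set R, is_ideal I ->
    exists (n : nat) (g : 'I_n -> R), I = ideal_span g.

Definition is_submodule (R : idomainType) (I : set {fraction R}) : Prop :=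
  [/\ I 0, forall x y, I x -> I y -> I (x + y) &
      forall (r : R) x, I x -> I (FracField.tofrac r * x)].

Definition submodule_prod (R : idomainType) (I J : set {fraction R}) :
  set {fraction R} :=
  [set z | exists (n : nat) (x y : 'I_n -> {fraction R}),
    [/\ forall i, I (x i), forall i, J (y i) & z = \sum_(i < n) x i * y i]].

(* R inside its fraction field is the range of the embedding [FracField.tofrac]. *)
Definition is_invertible (R : idomainType) (I : set {fraction R}) : Prop :=
  is_submodule I /\
  exists2 J : set {fraction R},
    is_submodule J & submodule_prod I J = range (@FracField.tofrac R).

(* Main.v *)
Require Import Defs.
From HB Require Import structures.
From mathcomp Require Import all_boot all_order all_algebra.
From mathcomp Require Import boolp classical_sets.

(** Both sides say that [R] has a uniformizer: a nonzero nonunit [t] such that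
    every nonzero element is a unit times a power of [t]. This condition lives
    inside [R] and mentions neither the field on which a valuation is given nor
    a maximal ideal, so each side is compared with it separately.

    Valuations. In [O_v], any [t] with [v t = 1] is a uniformizer, because [v]
    decides divisibility ([dvr_uniformizer]). Conversely, a uniformizer gives
    each nonzero fraction a unique expression [u * t ^ n] with [u] a unit of
    [R] and [n] an integer; the exponent [n] is a discrete valuation of
    [{fraction R}], and its valuation ring is exactly the image of [R]
    ([uniformizer_dvr]).

    Ideals. If [t] is a uniformizer, a nonzero ideal is generated by the
    smallest power of [t] that it contains, the nonunits are exactly the
    multiples of [t], and [t^-1 R] is inverse to [t R] ([uniformizer_local],
    [uniformizer_noetherian], [uniformizer_invertible]). Conversely, let [M] be
    the only maximal ideal. By Zorn's lemma it contains all nonunits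
    ([nonunit_maximal]). If [M J = R], then 1 is a finite sum of products
    [x y] in [R] with [x] in [M], [y] in [J], and locality makes one of these
    products a unit; dividing by it shows that [x] generates [M]
    ([invertible_maximal_principal]). Finally the Noetherian condition prevents
    a nonzero element from being divisible by all powers of a generator [t]
    of [M] ([noetherian_finite_order]), so removing [t] as often as possible
    leaves a unit ([uniformizer_of_generator]). *)

Import Order.TTheory GRing.Theory Num.Theory.
Local Open Scope classical_set_scope.
Local Open Scope ring_scope.

Local Notation "x %:F" := (FracField.tofrac x).

(** * Ideals and fractions *)

Definition is_uniformizer {R : idomainType} (t : R) : Prop :=
  [/\ t != 0, t \isn't a GRing.unit &
      forall x, x != 0 ->
        exists n, exists2 u, u \is a GRing.unit & x = u * t ^+ n].

Definition principal_ideal {R : comNzRingType} (t : R) : set R :=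
  [set x | exists r, x = r * t].

Lemma principal_ideal_ideal {R : comNzRingType} (t : R) :
  is_ideal (principal_ideal t).
Proof.
split=> [|x y [a ->] [b ->]|r x [a ->]].
- by exists 0; rewrite mul0r.
- by exists (a + b); rewrite mulrDl.
- by exists (r * a); rewrite mulrA.
Qed.

Lemma ideal_sum {R : comNzRingType} {I : set R} (n : nat) (x : 'I_n -> R) :
  is_ideal I -> (forall i, I (x i)) -> I (\sum_(i < n) x i).
Proof. by case=> I0 ID _ Ix; elim/big_ind: _. Qed.

Lemma ideal_unit {R : idomainType} {I : set R} {u : R} :
  is_ideal I -> I u -> u \is a GRing.unit -> I = [set: R].
Proof.
move=> [_ _ IM] Iu uU; apply/seteqP; split=> // x _.
by rewrite -(divrK uU x); apply: IM.
Qed.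

Lemma maximal_nonunit {R : idomainType} {M : set R} {x : R} :
  is_maximal_ideal M -> M x -> x \isn't a GRing.unit.
Proof. by case=> iM MT _ Mx; apply/negP => /(ideal_unit iM Mx). Qed.

Lemma frac_quotient {R : idomainType} (z : {fraction R}) :
  exists a b, b != 0 /\ z = a%:F / b%:F.
Proof.
elim/quotW: z => x; exists \n_x, \d_x; split; first exact: denom_ratioP.
have d0 : (\d_x)%:F != 0 by rewrite tofrac_eq0 denom_ratioP.
apply: (mulIf d0); rewrite mulfVK //.
unlock FracField.tofrac; rewrite -[LHS]FracField.pi_mul.
apply/eqmodP; rewrite /= FracField.equivfE /FracField.mulf.
by rewrite !numden_Ratio ?mulr1 ?oner_eq0 ?denom_ratioP // mulrC.
Qed.

(** * From a valuation to a uniformizer *)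

Lemma dv_div {K : fieldType} (v : discrete_valuation K) (x y : K) :
  x != 0 -> y != 0 -> v (x / y) = v x - v y.
Proof.
move=> x0 y0; apply/esym/eqP; rewrite subr_eq -dvM ?divfK //.
by rewrite mulf_neq0 ?invr_eq0.
Qed.

Lemma dvX {K : fieldType} (v : discrete_valuation K) (x : K) (n : nat) :
  x != 0 -> v (x ^+ n) = v x *+ n.
Proof.
move=> x0; elim: n => [|n IHn]; first by rewrite dv1.
by rewrite exprS dvM ?expf_neq0 // IHn mulrS.
Qed.

(** The valuation is pulled back to [R] along the isomorphism; the element
    [u = x / t ^ n] with [n = v x], and its inverse, both have valuation 0 and
    therefore come from [R]. *)
Lemma dvr_uniformizer {R : idomainType} :
  is_dvr R -> exists t : R, is_uniformizer t.
Proof.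
case=> K [v [f [g fK gK]]].
pose h (x : R) : K := val (f x).
have h1 : h 1 = 1 by rewrite /h rmorph1.
have hM x y : h (x * y) = h x * h y by rewrite /h rmorphM.
have hX x n : h (x ^+ n) = h x ^+ n.
  by elim: n => [|n IHn]; rewrite ?h1 ?expr0 // !exprS hM IHn.
have h_inj : injective h by move=> x y /val_inj /(can_inj fK).
have h_0 : h 0 = 0 by rewrite /h rmorph0.
have h0 x : (h x == 0) = (x == 0).
  by rewrite -{1}h_0 (inj_eq h_inj).
have h_onto (z : K) : 0 <= v z -> exists x, h x = z.
  move=> vz; have zP : z \in valuation_ring_pred v by rewrite inE vz orbT.
  by exists (g (exist _ z zP)); rewrite /h gK.
have vh x : x != 0 -> 0 <= v (h x).
  by rewrite -h0 => hx0; have := valP (f x); rewrite inE -/(h x) (negPf hx0).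
have hU x : x != 0 -> v (h x) = 0 -> x \is a GRing.unit.
  move=> x0 vx0; have hx0 : h x != 0 by rewrite h0.
  have [|y hy] := h_onto (1 / h x).
    by rewrite dv_div ?oner_eq0 // dv1 vx0.
  apply/unitrPr; exists y; apply: h_inj.
  by rewrite hM hy h1 mul1r divff.
have [z z0 vz] := dv_surj v 1.
have [|t ht] := h_onto z; first by rewrite vz.
have t0 : t != 0 by rewrite -h0 ht.
exists t; split=> // [|x x0].
  apply/negP => /unitrPr [s ts].
  have s0 : s != 0 by apply: contra_eqN ts => /eqP->; rewrite mulr0 eq_sym oner_eq0.
  have := dv1 v; rewrite -h1 -ts hM dvM ?h0 // ht vz => v1s.
  by have := ler_wpDr (vh s s0) (lexx 1); rewrite v1s.
exists `|v (h x)|%N; have hx0 : h x != 0 by rewrite h0.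
have tn0 : z ^+ `|v (h x)|%N != 0 by rewrite expf_neq0.
have vu : v (h x / z ^+ `|v (h x)|%N) = 0.
  by rewrite dv_div // dvX // vz natz gez0_abs ?vh // subrr.
have [|u hu] := h_onto (h x / z ^+ `|v (h x)|%N); first by rewrite vu.
exists u; last by apply: h_inj; rewrite hM hX ht hu divfK.
by apply: hU; rewrite ?hu // -h0 hu mulf_neq0 ?invr_eq0.
Qed.

(** * From a uniformizer to a valuation *)

(** This is what makes the exponent of [t] in a fraction well defined. *)
Lemma frac_pow_unit {R : idomainType} {t u : R} {n : int} :
  t \isn't a GRing.unit -> u \is a GRing.unit -> t%:F ^ n = u%:F -> n = 0.
Proof.
move=> tU uU; have tnU k : t ^+ k.+1 \isn't a GRing.unit by rewrite unitrX_pos.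
case: n => [[//|n]|n].
  by rewrite -exprnP -tofracXn => /eqP; rewrite tofrac_eq => /eqP tn;
    case/negP: (tnU n); rewrite tn.
rewrite NegzE -exprnN -tofracXn => tn.
have tn0 : (t ^+ n.+1)%:F != 0.
  apply: contraTneq uU => t0; have := tn.
  rewrite t0 invr0 => /esym/eqP; rewrite tofrac_eq0 => /eqP->.
  by rewrite unitr0.
have /eqP : (t ^+ n.+1 * u)%:F = 1%:F by rewrite tofracM -tn divff ?tofrac1.
rewrite tofrac_eq => /eqP tu1.
by case/negP: (tnU n); apply/unitrPr; exists u.
Qed.

Section Uniformizer.

Context {R : idomainType} {t : R} (tP : is_uniformizer t).

Let t0 : t != 0. Proof. by case: tP. Qed.
Let tU : t \isn't a GRing.unit. Proof. by case: tP. Qed.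
Let tF0 : t%:F != 0. Proof. by rewrite tofrac_eq0. Qed.

Lemma frac_unit_pow (x : {fraction R}) : x != 0 ->
  exists n : int, exists2 u, u \is a GRing.unit & x = u%:F * t%:F ^ n.
Proof.
case: tP => _ _ tx; have [a [b [b0 ->]]] := frac_quotient x => ab0.
have a0 : a != 0 by apply: contraNneq ab0 => ->; rewrite tofrac0 mul0r.
have [m [u uU ->]] := tx a a0; have [n [w wU ->]] := tx b b0.
exists (m%:Z - n%:Z); exists (u / w); first by rewrite unitrM uU unitrV.
have wF0 : w%:F != 0 by rewrite tofrac_eq0; apply: contraTneq wU => ->; rewrite unitr0.
have -> : (u / w)%:F = u%:F / w%:F.
  by apply: (mulIf wF0); rewrite -tofracM !divrK // unitfE.
rewrite !tofracM !tofracXn expfzDr // -exprnN invfM -exprnP.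
by rewrite -!mulrA; congr (_ * _); rewrite mulrCA.
Qed.

Lemma frac_unit_pow_inj (u w : R) (m n : int) :
  u \is a GRing.unit -> w \is a GRing.unit ->
  u%:F * t%:F ^ m = w%:F * t%:F ^ n -> m = n.
Proof.
move=> uU wU e; apply/eqP; rewrite -subr_eq0; apply/eqP.
apply: (@frac_pow_unit _ t (w / u)); rewrite ?unitrM ?wU ?unitrV //.
have uF0 : u%:F != 0 by rewrite tofrac_eq0; apply: contraTneq uU => ->; rewrite unitr0.
apply: (mulfI uF0); rewrite -tofracM mulrC [u * _]mulrC divrK // mulrC.
by rewrite expfzDr // mulrA e -mulrA -expfzDr // subrr expr0z mulr1.
Qed.

Lemma frac_order_exists : {v : {fraction R} -> int |
  forall x, x != 0 ->
    exists2 u, u \is a GRing.unit & x = u%:F * t%:F ^ v x}.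
Proof.
suff [v vP] : {v : {fraction R} -> int & forall x, x != 0 ->
    exists2 u, u \is a GRing.unit & x = u%:F * t%:F ^ v x} by exists v.
apply: (@choice _ _ (fun x n => x != 0 ->
  exists2 u, u \is a GRing.unit & x = u%:F * t%:F ^ n)) => x.
have [->|/frac_unit_pow [n xn]] := eqVneq x 0; first by exists 0.
by exists n.
Qed.

Definition frac_order : {fraction R} -> int := sval frac_order_exists.

Lemma frac_orderP {x : {fraction R}} : x != 0 ->
  exists2 u, u \is a GRing.unit & x = u%:F * t%:F ^ frac_order x.
Proof. exact: (svalP frac_order_exists). Qed.

Lemma frac_orderE (u : R) (n : int) :
  u \is a GRing.unit -> frac_order (u%:F * t%:F ^ n) = n.
Proof.
move=> uU; have x0 : u%:F * t%:F ^ n != 0.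
  rewrite mulf_neq0 ?expfz_neq0 // tofrac_eq0.
  by apply: contraTneq uU => ->; rewrite unitr0.
have [w wU e] := frac_orderP x0.
exact/esym/(frac_unit_pow_inj _ _ _ _ uU wU e).
Qed.

Lemma frac_order_tofrac (x : R) : x != 0 -> 0 <= frac_order x%:F.
Proof.
case: tP => _ _ tx /tx [n [u uU ->]].
by rewrite tofracM tofracXn exprnP frac_orderE.
Qed.

Lemma frac_order_ge0 (x : {fraction R}) :
  x != 0 -> 0 <= frac_order x -> exists y : R, x = y%:F.
Proof.
move=> /frac_orderP [u _]; case: (frac_order x) => [n|//] xE _.
by exists (u * t ^+ n); rewrite xE tofracM tofracXn.
Qed.

Lemma frac_orderM (x y : {fraction R}) : x != 0 -> y != 0 ->
  frac_order (x * y) = frac_order x + frac_order y.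
Proof.
move=> x0 y0; have [u uU ex] := frac_orderP x0; have [w wU ey] := frac_orderP y0.
rewrite {1}ex {1}ey mulrACA -tofracM -expfzDr //.
by rewrite frac_orderE // unitrM uU.
Qed.

Lemma frac_order_surj (n : int) :
  exists2 x : {fraction R}, x != 0 & frac_order x = n.
Proof.
exists (t%:F ^ n); first by rewrite expfz_neq0.
by rewrite -[t%:F ^ n]mul1r -tofrac1 frac_orderE ?unitr1.
Qed.

(** Dividing by the summand [x] of smaller order reduces the inequality to
    the fact that [1 + y / x], an element of [R], has nonnegative order. *)
Lemma frac_orderD (x y : {fraction R}) : x != 0 -> y != 0 -> x + y != 0 ->
  Num.min (frac_order x) (frac_order y) <= frac_order (x + y).
Proof.
move=> x0 y0 xy0; wlog le_xy : x y x0 y0 xy0 / frac_order x <= frac_order y.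
  move=> W; have [le_xy|/ltW le_yx] := leP (frac_order x) (frac_order y).
    by rewrite -(min_l le_xy) W.
  by rewrite -(min_r le_yx) addrC minC W // addrC.
rewrite (min_l le_xy).
have yx0 : y / x != 0 by rewrite mulf_neq0 ?invr_eq0.
have [|r yxE] := frac_order_ge0 _ yx0.
  by rewrite -(lerD2r (frac_order x)) -frac_orderM // divfK // add0r.
have xyE : x + y = x * (1 + r)%:F.
  by rewrite tofracD tofrac1 -yxE mulrDr mulr1 mulrC divfK.
have r0 : (1 + r)%:F != 0.
  by apply: contraNneq xy0 => r0; rewrite xyE r0 mulr0.
by rewrite xyE frac_orderM // lerDl frac_order_tofrac // -tofrac_eq0.
Qed.

Definition frac_valuation : discrete_valuation {fraction R} :=
  DiscreteValuation frac_orderM frac_order_surj frac_orderD.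

Lemma tofrac_valuation_ring (x : R) :
  x%:F \in valuation_ring_pred frac_valuation.
Proof.
rewrite inE tofrac_eq0; have [//|x0 /=] := eqVneq x 0.
exact: frac_order_tofrac.
Qed.

Definition to_valuation_ring (x : R) : valuation_ring frac_valuation :=
  exist _ x%:F (tofrac_valuation_ring x).

Lemma to_valuation_ring_zmod_morphism : zmod_morphism to_valuation_ring.
Proof. by move=> x y; apply: val_inj; rewrite /= tofracB. Qed.

Lemma to_valuation_ring_monoid_morphism : monoid_morphism to_valuation_ring.
Proof.
by split=> [|x y]; apply: val_inj; rewrite /= ?tofrac1 ?tofracM.
Qed.

Lemma to_valuation_ring_bij : bijective to_valuation_ring.
Proof.
have onto (z : valuation_ring frac_valuation) : exists x, x%:F = val z.
  have := valP z; rewrite inE; have [-> _|z0 /= vz] := eqVneq (val z) 0.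
    by exists 0; rewrite tofrac0.
  by have [y ->] := frac_order_ge0 _ z0 vz; exists y.
have [g gP] := choice onto.
exists g => [x|z]; last by apply: val_inj; rewrite /= gP.
by apply/eqP; rewrite -tofrac_eq gP.
Qed.

Lemma uniformizer_dvr : is_dvr R.
Proof.
pose f : {rmorphism R -> valuation_ring frac_valuation} :=
  HB.pack to_valuation_ring
    (GRing.isZmodMorphism.Build _ _ _ to_valuation_ring_zmod_morphism)
    (GRing.isMonoidMorphism.Build _ _ _ to_valuation_ring_monoid_morphism).
exists {fraction R}, frac_valuation, f; exact: to_valuation_ring_bij.
Qed.

(** * Ideals of a ring with a uniformizer *)

Lemma uniformizer_nonunit (x : R) :
  x \isn't a GRing.unit -> principal_ideal t x.
Proof.
case: tP => _ _ tx; have [-> _|/tx [[|n] [u uU ->]]] := eqVneq x 0.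
- by exists 0; rewrite mul0r.
- by rewrite expr0 mulr1 uU.
- by move=> _; exists (u * t ^+ n); rewrite exprSr mulrA.
Qed.

Lemma uniformizer_nontrivial : principal_ideal t <> [set: R].
Proof.
move=> e; have [r r1] : principal_ideal t 1 by rewrite e.
by case/negP: tU; apply/unitrPr; exists r; rewrite mulrC.
Qed.

Lemma uniformizer_maximal : is_maximal_ideal (principal_ideal t).
Proof.
split=> [||J iJ tJ]; first exact: principal_ideal_ideal.
  exact: uniformizer_nontrivial.
have [[x Jx xU]|noU] := pselect (exists2 x, J x & x \is a GRing.unit).
  by right; apply: ideal_unit iJ Jx xU.
left; apply/seteqP; split=> // x Jx; apply: uniformizer_nonunit.
by apply/negP => xU; apply: noU; exists x.
Qed.

Lemma uniformizer_maximalE {M : set R} :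
  is_maximal_ideal M -> M = principal_ideal t.
Proof.
move=> mM; case: (mM) => _ _ maxM.
have sub : M `<=` principal_ideal t.
  by move=> x Mx; apply/uniformizer_nonunit/(maximal_nonunit mM Mx).
by have [->|/uniformizer_nontrivial] := maxM _ (principal_ideal_ideal t) sub.
Qed.

Lemma uniformizer_local : is_local R.
Proof.
by exists (principal_ideal t); split=> [|M /uniformizer_maximalE];
  first exact: uniformizer_maximal.
Qed.

Lemma ideal_span1 (x : R) : ideal_span (fun _ : 'I_1 => x) = principal_ideal x.
Proof.
apply/seteqP; split=> y [a ->]; first by exists (a ord0); rewrite big_ord1.
by exists (fun=> a); rewrite big_ord1.
Qed.

Lemma uniformizer_noetherian : is_noetherian R.
Proof.
move=> I iI; have [I0 _ IM] := iI; exists 1.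
have [[x Ix x0]|triv] := pselect (exists2 x, I x & x != 0); last first.
  exists (fun=> 0); rewrite ideal_span1; apply/seteqP; split=> [x Ix|x [r ->]].
    have [->|x0] := eqVneq x 0; first by exists 0; rewrite mul0r.
    by case: triv; exists x.
  by rewrite mulr0.
case: tP => _ _ tx.
have Ipow u n : u \is a GRing.unit -> I (u * t ^+ n) -> I (t ^+ n).
  by move=> uU Iutn; rewrite -[t ^+ n](mulKr uU); apply: IM.
have exn : exists n, `[< I (t ^+ n) >].
  have [n [u uU xE]] := tx x x0; exists n; apply/asboolP.
  by apply: (Ipow u) => //; rewrite -xE.
have [n /asboolP In minn] := ex_minnP exn.
exists (fun=> t ^+ n); rewrite ideal_span1.
apply/seteqP; split=> [y Iy|y [r ->]]; last exact: IM.
have [->|y0] := eqVneq y 0; first by exists 0; rewrite mul0r.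
have [m [u uU yE]] := tx y y0.
have le_nm : (n <= m)%N by apply/minn/asboolP/(Ipow u); rewrite -?yE.
by exists (u * t ^+ (m - n)); rewrite yE -mulrA -exprD subnK.
Qed.

End Uniformizer.

Lemma principal_invertible {R : idomainType} {t : R} :
  t != 0 -> is_invertible (@FracField.tofrac R @` principal_ideal t).
Proof.
move=> t0; have tF0 : t%:F != 0 by rewrite tofrac_eq0.
split.
  split=> [|_ _ [_ [a ->] <-] [_ [b ->] <-]|r _ [_ [a ->] <-]].
  - by exists 0; rewrite ?tofrac0 //; exists 0; rewrite mul0r.
  - by exists ((a + b) * t); [exists (a + b)|rewrite -tofracD mulrDl].
  - by exists (r * a * t); [exists (r * a)|rewrite -mulrA tofracM].
exists [set z | exists r : R, z = r%:F / t%:F].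
  split=> [|_ _ [a ->] [b ->]|r _ [a ->]].
  - by exists 0; rewrite tofrac0 mul0r.
  - by exists (a + b); rewrite tofracD mulrDl.
  - by exists (r * a); rewrite tofracM mulrA.
apply/seteqP; split=> [z [n [x [y [Ix Jy ->]]]]|_ [r _ <-]].
  elim/big_ind: _ => [|_ _ [a _ <-] [b _ <-]|i _].
  - by exists 0; rewrite ?tofrac0.
  - by exists (a + b); rewrite ?tofracD.
  - have [_ [a ->] <-] := Ix i; have [b ->] := Jy i.
    by exists (a * b) => //; rewrite !tofracM mulrA mulrAC mulfK.
exists 1%N, (fun=> t%:F), (fun=> r%:F / t%:F); split=> [i|i|].
- by exists t => //; exists 1; rewrite mul1r.
- by exists r.
- by rewrite big_ord1 mulrC divfK.
Qed.

(** * From an invertible maximal ideal to a uniformizer *)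

(** Zorn's lemma applies to the proper ideals containing [x]; the empty set is
    added to them because it is the union of the empty chain. *)
Lemma nonunit_maximal {R : idomainType} {x : R} :
  x \isn't a GRing.unit -> exists2 M : set R, is_maximal_ideal M & M x.
Proof.
move=> xU.
pose P (I : set R) := I = set0 \/ [/\ is_ideal I, I x & ~ I 1].
have [|M [PM maxM]] := @Zorn_bigcup _ P.
  move=> F FP totF; set U := \bigcup_(X in F) X.
  have [[y Uy]|U0] := pselect (exists y, U y); last first.
    by left; apply/seteqP; split=> // y Uy; case: U0; exists y.
  have mem X z : F X -> X z -> [/\ is_ideal X, X x & ~ X 1].
    by move=> /FP [->|].
  right; split; first split.
  - case: Uy => X FX Xy; exists X => //.
    by have [[]] := mem X y FX Xy.
  - move=> a b [X FX Xa] [Y FY Yb].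
    have [XY|YX] := totF X Y FX FY.
      by exists Y => //; have [[_ D _] _ _] := mem Y b FY Yb; apply: D => //; apply: XY.
    by exists X => //; have [[_ D _] _ _] := mem X a FX Xa; apply: D => //; apply: YX.
  - move=> r a [X FX Xa]; exists X => //.
    by have [[_ _ IM] _ _] := mem X a FX Xa; apply: IM.
  - case: Uy => X FX Xy; exists X => //.
    by have [] := mem X y FX Xy.
  - by case=> X FX X1; have [] := mem X 1 FX X1.
have xP : P (principal_ideal x).
  right; split; first exact: principal_ideal_ideal.
    by exists 1; rewrite mul1r.
  by case=> r r1; case/negP: xU; apply/unitrPr; exists r; rewrite mulrC.
have [M0|[iM Mx M1]] := PM.
  case: (maxM _ _ xP); rewrite M0; split=> // px0.
  by apply: (px0 x); exists 1; rewrite mul1r.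
exists M => //; split=> // [MT|J iJ MJ]; first by apply: M1; rewrite MT.
have [J1|J1] := pselect (J 1); first by right; apply: ideal_unit iJ J1 (unitr1 _).
left; apply: contrapT => JM; apply: (maxM J); last by right; split=> //; apply: MJ.
by split=> // JsM; apply: JM; apply/seteqP.
Qed.

Lemma local_nonunit {R : idomainType} {M : set R} {x : R} :
  is_local R -> is_maximal_ideal M -> x \isn't a GRing.unit -> M x.
Proof.
move=> [N [_ uniqN]] mM /nonunit_maximal [L mL Lx].
by rewrite -(uniqN M mM) (uniqN L mL).
Qed.

(** In [1 = \sum_i x_i y_i] some [x_i y_i] is a unit [r], as the nonunits form
    the ideal [M]; then [m = (m y_i / r) x_i] with [m y_i] in [R] for [m] in
    [M]. *)
Lemma invertible_maximal_principal {R : idomainType} {M : set R} :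
  is_local R -> is_maximal_ideal M ->
  is_invertible (@FracField.tofrac R @` M) ->
  exists2 t, t != 0 & M = principal_ideal t.
Proof.
move=> locR mM [_ [J _ MJ]]; have [iM MT _] := mM; have [_ _ MM] := iM.
have inR m z : M m -> J z -> exists r : R, m%:F * z = r%:F.
  move=> Mm Jz; suff [r _ <-] : range (@FracField.tofrac R) (m%:F * z) by exists r.
  rewrite -MJ; exists 1%N, (fun=> m%:F), (fun=> z).
  by split=> //; rewrite big_ord1.
have : range (@FracField.tofrac R) 1 by exists 1; rewrite ?tofrac1.
rewrite -MJ => -[n [x [y [Mx Jy sum1]]]].
have /choice [s sP] i : exists s : R, M s /\ x i = s%:F.
  by have [s Ms <-] := Mx i; exists s.
have /choice [r rP] i : exists r : R, x i * y i = r%:F.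
  by have [Ms ->] := sP i; apply: inR.
have [[i rU]|noU] := pselect (exists i, r i \is a GRing.unit); last first.
  have M1 : M (\sum_(i < n) r i).
    apply: ideal_sum => // i; apply: local_nonunit => //.
    by apply/negP => rU; apply: noU; exists i.
  case: MT; apply: (ideal_unit iM M1).
  suff -> : \sum_(i < n) r i = 1 by apply: unitr1.
  apply/eqP; rewrite -tofrac_eq rmorph_sum tofrac1 sum1.
  by apply/eqP; apply: eq_bigr => i _; rewrite rP.
have [Ms xE] := sP i; have rE := rP i; rewrite xE in rE.
have rF0 : (r i)%:F != 0.
  by rewrite tofrac_eq0; apply: contraTneq rU => ->; rewrite unitr0.
exists (s i).
  by apply: contraNneq rF0 => s0; rewrite -rE s0 tofrac0 mul0r.
apply/seteqP; split=> [m Mm|m [a ->]]; last exact: MM.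
have [q qE] := inR m (y i) Mm (Jy i); exists (q / r i).
apply: (mulIr rU); rewrite mulrAC divrK //.
apply/eqP; rewrite -tofrac_eq !tofracM -rE -qE; apply/eqP.
by rewrite mulrAC mulrA mulrAC.
Qed.

(** The elements [y] with [t ^ n * y] in [x R] for some [n] form an ideal, and
    a single exponent [N] works for a finite set of generators, hence for the
    whole ideal. If [x = y * t ^ N.+1], then [y] is in this ideal, so [x]
    divides [y * t ^ N]; cancelling [y * t ^ N] makes [t] a unit. *)
Lemma noetherian_finite_order {R : idomainType} {t x : R} :
  is_noetherian R -> t \isn't a GRing.unit -> x != 0 ->
  exists n, ~ principal_ideal (t ^+ n) x.
Proof.
move=> noeR tU x0.
have [px0 pxD pxM] := principal_ideal_ideal x.
pose I := [set y | exists n, principal_ideal x (t ^+ n * y)].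
have mono m n y : (m <= n)%N ->
    principal_ideal x (t ^+ m * y) -> principal_ideal x (t ^+ n * y).
  by move=> /subnK <- ?; rewrite exprD -mulrA; apply: pxM.
have iI : is_ideal I.
  split=> [|y z [m ym] [n zn]|r y [n yn]].
  - by exists 0%N; rewrite mulr0.
  - exists (maxn m n); rewrite mulrDr.
    by apply: pxD; [apply: mono ym|apply: mono zn];
      rewrite ?leq_maxl ?leq_maxr.
  - by exists n; rewrite mulrCA; apply: pxM.
have [k [g gI]] := noeR I iI.
have /choice [e eP] i : exists n, principal_ideal x (t ^+ n * g i).
  suff: I (g i) by [].
  rewrite gI; exists (fun j => (j == i)%:R).
  by rewrite (bigD1 i) //= eqxx mul1r big1 ?addr0 // => j /negPf ->; rewrite mul0r.
pose N := \max_(i < k) e i.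
have NP y : I y -> principal_ideal x (t ^+ N * y).
  rewrite gI => -[a ->]; rewrite mulr_sumr.
  apply: (ideal_sum _ _ (principal_ideal_ideal x)) => i; rewrite mulrCA.
  by apply: pxM; apply: mono (eP i); apply: (leq_bigmax i).
exists N.+1 => -[y xE].
have [|c cE] := NP y; first by exists N.+1; exists 1; rewrite mul1r xE mulrC.
have ty0 : y * t ^+ N != 0.
  by apply: contraNneq x0 => ty0; rewrite xE exprSr mulrA ty0 mul0r.
case/negP: tU; apply/unitrPr; exists c.
by apply: (mulfI ty0); rewrite mulr1 [RHS]mulrC cE xE exprSr !mulrA mulrC !mulrA.
Qed.

Lemma uniformizer_of_generator {R : idomainType} {t : R} :
  is_local R -> is_noetherian R -> t != 0 ->
  is_maximal_ideal (principal_ideal t) -> is_uniformizer t.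
Proof.
move=> locR noeR t0 mt.
have tU : t \isn't a GRing.unit.
  by apply: (maximal_nonunit mt); exists 1; rewrite mul1r.
split=> // x x0.
have exn : exists n, `[< ~ principal_ideal (t ^+ n) x >].
  by have [n xn] := noetherian_finite_order noeR tU x0; exists n; apply/asboolP.
have [[|n] /asboolP xn minn] := ex_minnP exn.
  by case: xn; exists x; rewrite expr0 mulr1.
have [u xE] : principal_ideal (t ^+ n) x.
  apply: contrapT => /asboolP /minn; by rewrite ltnn.
exists n, u => //; apply: contrapT => /negP /(local_nonunit locR mt) [r uE].
by apply: xn; exists r; rewrite xE uE exprS mulrA.
Qed.

Theorem theorem22 (R : idomainType) :
  is_dvr R <->
  [/\ is_local R, is_noetherian R &
      forall M : set R, is_maximal_ideal M -> is_invertible (@FracField.tofrac R @` M)].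
Proof.
split=> [/dvr_uniformizer [t tP]|[locR noeR invR]].
  split; [exact: uniformizer_local tP|exact: uniformizer_noetherian tP|].
  move=> M /(uniformizer_maximalE tP) ->.
  by case: tP => t0 _ _; apply: principal_invertible.
have [M [mM _]] := locR.
have [t t0 ME] := invertible_maximal_principal locR mM (invR M mM).
by apply: (@uniformizer_dvr _ t); apply: uniformizer_of_generator; rewrite -?ME.
Qed.
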